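(* Let $\Bbbk$ be a commutative ring and let $(R,C,\partial,\mathrm{tr})$ be a Poisson trace order over $\Bbbk$. (1) For every positive integer $\ell$, the modified discriminant ideal $MD_\ell(R/C,\mathrm{tr})$ is a Poisson ideal of $C$ with respect to the underlying Poisson structure on $C$. (2) Suppose that $\Bbbk$ is a field, $C$ is a finitely generated $\Bbbk$-algebra, and either (a) $R$ is a maximal order, $C=\mathcal{Z}(R)$ is the center of $R$ and $\mathrm{tr}:R\to C$ is the reduced trace, or (b) $(R,C,\mathrm{tr})$ is a Cayley–Hamilton algebra of degree $d$ such that $\mathrm{char}\,\Bbbk\notin[1,d]$. Then for every positive integer $\ell$ the zero set in $\mathrm{MaxSpec}\,C$ of the discriminant ideal $D_\ell(R/C,\mathrm{tr})$ is a union of symplectic cores of $\mathrm{MaxSpec}\,C$.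
   Context: $\Bbbk$ is a commutative base ring; algebras are associative unital $\Bbbk$-algebras and Poisson algebras are commutative with $\Bbbk$-bilinear Poisson bracket. Poisson order: a triple $(R,C,\partial)$ where $C$ is a central $\Bbbk$-subalgebra of the $\Bbbk$-algebra $R$, $R$ is a finitely generated $C$-module, $C$ is equipped with a Poisson algebra structure $\{.,.\}$, and $\partial:C\to\mathrm{Der}_\Bbbk(R)$ is a $\Bbbk$-linear map such that $\partial_c|_C=\{c,-\}$ for all $c\in C$. Trace map: a $C$-linear map $\mathrm{tr}:R\to C$ with $\mathrm{tr}(xy)=\mathrm{tr}(yx)$. Poisson trace order: a quadruple $(R,C,\partial,\mathrm{tr})$ with $(R,C,\partial)$ a Poisson order and $\mathrm{tr}$ a trace map such that $\mathrm{tr}(\partial_c(r))=\{c,\mathrm{tr}(r)\}$ for all $c\in C$, $r\in R$. Discriminant ideals: $MD_\ell(R/C,\mathrm{tr})$ is the ideal of $C$ generated by all $\det\big(\mathrm{tr}(r_is_j)\big)_{i,j=1}^\ell$ with $(r_1,\dots,r_\ell),(s_1,\dots,s_\ell)\in R^\ell$; $D_\ell(R/C,\mathrm{tr})$ is the ideal of $C$ generated by all $\det\big(\mathrm{tr}(r_ir_j)\big)_{i,j=1}^\ell$ with $(r_1,\dots,r_\ell)\in R^\ell$. A Poisson ideal of $C$ is an ideal $I$ with $\{C,I\}\subseteq I$. Symplectic cores: for an ideal $I$ of $C$ let $\mathcal{P}(I)$ be the largest Poisson ideal of $C$ contained in $I$. The symplectic core of $\mathfrak{m}\in\mathrm{MaxSpec}\,C$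 is $\{\mathfrak{n}\in\mathrm{MaxSpec}\,C\mid\mathcal{P}(\mathfrak{n})=\mathcal{P}(\mathfrak{m})\}$. Maximal order and reduced trace: let $R$ be prime and a finitely generated module over its center $\mathcal{Z}(R)$, with $Q$ the fraction field of $\mathcal{Z}(R)$; $R\otimes_{\mathcal{Z}(R)}Q$ is a central simple $Q$-algebra, the quotient ring of $R$. $R$ is a maximal order if there is no ring $S$ with $R\subsetneq S\subseteq R\otimes_{\mathcal{Z}(R)}Q$ and $aSb\subseteq R$ for some units $a,b$ of $R\otimes_{\mathcal{Z}(R)}Q$; in this case $\mathcal{Z}(R)$ is normal. Choosing a finite field extension $F/Q$ with $R\otimes_{\mathcal{Z}(R)}F\cong M_n(F)$, the reduced trace is the composition $R\hookrightarrow R\otimes_{\mathcal{Z}(R)}Q\to R\otimes_{\mathcal{Z}(R)}F\cong M_n(F)\to F$ with last map the matrix trace; it takes values in $\mathcal{Z}(R)$ when $\mathcal{Z}(R)$ is normal. Cayley–Hamilton algebra of degree $d$ (a positive integer; $\Bbbk$ a field of characteristic $0$ or $>d$): let $\sigma_k$ and $\psi_k=\lambda_1^k+\dots+\lambda_d^k$ be the elementary symmetric and power sum functions in $\lambda_1,\dots,\lambda_d$, and let $p_k(x_1,\dots,x_k)\in\mathbb{Z}[(k!)^{-1}][x_1,\dots,x_k]$ be the unique polynomials with $\sigma_k=p_k(\psi_1,\dots,\psi_k)$ for $1\le k\le d$. For an algebra with trace $(R,C,\mathrm{tr})$ and $a\in R$ put $c_k(a)=p_k(\mathrm{tr}(a),\mathrm{tr}(a^2),\dots,\mathrm{tr}(a^k))$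 and $\chi_{d,a}(t)=t^d-c_1(a)t^{d-1}+\dots+(-1)^dc_d(a)\in C[t]$. Then $(R,C,\mathrm{tr})$ is a Cayley–Hamilton algebra of degree $d$ if $\chi_{d,a}(a)=0$ for all $a\in R$ and $\mathrm{tr}(1)=d$. *)

(* Defs.v *)
From HB Require Import structures.
From mathcomp Require Import all_boot all_order all_algebra all_field.
From mathcomp Require Import boolp classical_sets.
From mathcomp Require Import mpoly.

Set Implicit Arguments.
Unset Strict Implicit.
Unset Printing Implicit Defensive.

Import GRing.Theory.

Local Open Scope classical_set_scope.
Local Open Scope ring_scope.

Section Ideals.
Variable C : comNzRingType.
Implicit Types I J m : set C.

Definition is_ideal I : Prop :=
  [/\ I 0, forall x y, I x -> I y -> I (x + y)
    & forall a x, I x -> I (a * x)].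

Definition ideal_gen (G : set C) : set C := smallest is_ideal G.

Definition MaxSpec : set (set C) :=
  [set m | [/\ is_ideal m, ~ m 1
    & forall J, is_ideal J -> m `<=` J -> ~ J 1 -> J = m]].

Definition zero_set I : set (set C) := [set m | MaxSpec m /\ I `<=` m].

End Ideals.

Section PoissonAlgebra.
Variables (k : comNzRingType) (C : comAlgType k) (br : C -> C -> C).
Implicit Types I J m : set C.

Record is_poisson_bracket : Prop := {
  bracket_linear_l : forall y, linear (br^~ y);
  bracket_linear_r : forall x, linear (br x);
  bracket_alternating : forall x, br x x = 0;
  bracket_jacobi : forall x y z,
    br x (br y z) + br y (br z x) + br z (br x y) = 0;
  bracket_leibniz : forall x y z, br x (y * z) = br x y * z + y * br x z
}.

Definition is_poisson_ideal I : Prop :=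
  is_ideal I /\ forall c x, I x -> I (br c x).

(* The union of the Poisson ideals contained in [I]; it is itself a Poisson
   ideal, hence the largest one: see [poisson_core_largest]. *)
Definition poisson_core I : set C :=
  \bigcup_(J in [set J | is_poisson_ideal J /\ J `<=` I]) J.

Definition symplectic_core m : set (set C) :=
  [set n | MaxSpec n /\ poisson_core n = poisson_core m].

Definition is_union_of_symplectic_cores (V : set (set C)) : Prop :=
  exists F : set (set (set C)),
    (forall K, F K -> exists2 m, MaxSpec m & K = symplectic_core m) /\
    V = \bigcup_(K in F) K.

Lemma poisson_core_largest I :
    is_poisson_bracket -> is_ideal I ->
  [/\ is_poisson_ideal (poisson_core I), poisson_core I `<=` I
    & forall J, is_poisson_ideal J -> J `<=` I -> J `<=` poisson_core I].
Proof.
move=> Hbr [I0 ID IM]; split; last first.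
- by move=> J HJ JI x Jx; exists J.
- by move=> x [J [_ JI] /JI].
have brD c x y : br c (x + y) = br c x + br c y.
  by have := bracket_linear_r Hbr c 1 x y; rewrite !scale1r.
have br0 c : br c 0 = 0 by apply: (addrI (br c 0)); rewrite -brD !addr0.
split; first split.
- exists [set 0]; last by [].
  split; last by move=> _ ->.
  split; last by move=> c _ ->; rewrite br0.
  by split=> // [x y -> ->|a x ->]; rewrite ?addr0 ?mulr0.
- move=> x y [J [[[J0 JD JM] JP] JI] Jx] [L [[[L0 LD LM] LP] LI] Ly].
  exists [set z | exists a b, [/\ J a, L b & z = a + b]]; last by exists x, y.
  split; last by move=> _ [a [b [/JI Ia /LI Ib ->]]]; apply: ID.
  split; first split.
  + by exists 0, 0; rewrite addr0.
  + move=> _ _ [a [b [Ja Lb ->]]] [a' [b' [Ja' Lb' ->]]].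
    exists (a + a'), (b + b'); rewrite addrACA.
    by split=> //; [apply: JD | apply: LD].
  + move=> c _ [a [b [Ja Lb ->]]]; exists (c * a), (c * b); rewrite mulrDr.
    by split=> //; [apply: JM | apply: LM].
  + move=> c _ [a [b [Ja Lb ->]]]; exists (br c a), (br c b); rewrite brD.
    by split=> //; [apply: JP | apply: LP].
- move=> a x [J HJ Jx]; exists J => //.
  by case: HJ => [[[_ _ JM] _] _]; apply: JM.
- move=> c x [J HJ Jx]; exists J => //.
  by case: HJ => [[_ JP] _]; apply: JP.
Qed.

End PoissonAlgebra.

Definition fg_module (D R : nzRingType) (u : D -> R) : Prop :=
  exists (n : nat) (e : 'I_n -> R),
    forall r, exists c : 'I_n -> D, r = \sum_(i < n) u (c i) * e i.

Definition fg_algebra (k : comNzRingType) (C : comAlgType k) : Prop :=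
  exists (n : nat) (x : 'I_n -> C),
    forall c, exists p : {mpoly k[n]}, c = mmap (fun a : k => a%:A) x p.

Section PoissonOrder.
Variables (k : comNzRingType) (R : algType k) (C : comAlgType k).

Definition is_derivation (D : R -> R) : Prop :=
  linear D /\ forall x y, D (x * y) = D x * y + x * D y.

(* The central subalgebra of [R] is given as an abstract commutative algebra
   [C] together with its inclusion [iota] into [R]. *)
Variable iota : {lrmorphism C -> R}.

Record is_poisson_order (br : C -> C -> C) (d : C -> R -> R) : Prop := {
  order_inj : injective iota;
  order_central : forall c r, iota c * r = r * iota c;
  order_fg : fg_module iota;
  order_poisson : is_poisson_bracket br;
  order_der : forall c, is_derivation (d c);
  order_linear : forall r, linear (d^~ r);
  order_restrict : forall c c', d c (iota c') = iota (br c c')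
}.

Record is_trace_map (tr : R -> C) : Prop := {
  trace_add : forall x y, tr (x + y) = tr x + tr y;
  trace_scale : forall c x, tr (iota c * x) = c * tr x;
  trace_comm : forall x y, tr (x * y) = tr (y * x)
}.

Record is_poisson_trace_order
    (br : C -> C -> C) (d : C -> R -> R) (tr : R -> C) : Prop := {
  pto_order : is_poisson_order br d;
  pto_trace : is_trace_map tr;
  pto_compat : forall c r, tr (d c r) = br c (tr r)
}.

Definition MD (l : nat) (tr : R -> C) : set C :=
  ideal_gen [set x | exists r s : 'I_l -> R,
                     x = \det (\matrix_(i < l, j < l) tr (r i * s j))].

Definition discr (l : nat) (tr : R -> C) : set C :=
  ideal_gen [set x | exists r : 'I_l -> R,
                     x = \det (\matrix_(i < l, j < l) tr (r i * r j))].

Definition is_whole_center : Prop :=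
  forall x, (exists c, iota c = x) <-> (forall y, x * y = y * x).

End PoissonOrder.

Section Center.
Variable R : nzRingType.

Definition central_elts : {pred R} :=
  fun x => `[< forall y, x * y = y * x >].

Lemma central_eltsP x : reflect (forall y, x * y = y * x) (x \in central_elts).
Proof. exact: asboolP. Qed.

Fact central_subring : subring_closed central_elts.
Proof.
split=> [|x z /central_eltsP xP /central_eltsP zP
         |x z /central_eltsP xP /central_eltsP zP]; apply/central_eltsP => y.
- by rewrite mul1r mulr1.
- by rewrite mulrBl mulrBr xP zP.
- by rewrite -mulrA zP mulrA xP mulrA.
Qed.

HB.instance Definition _ :=
  GRing.isSubringClosed.Build R central_elts central_subring.

Record center := Center { center_val : R; _ : center_val \in central_elts }.

HB.instance Definition _ := [isSub for center_val].
HB.instance Definition _ := [Choice of center by <:].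
HB.instance Definition _ := [SubChoice_isSubNzRing of center by <:].

Fact center_mulC : @commutative center center *%R.
Proof.
by move=> x y; apply: val_inj; rewrite !rmorphM; exact/central_eltsP/valP.
Qed.

HB.instance Definition _ := GRing.PzRing_hasCommutativeMul.Build center center_mulC.

End Center.

Definition is_fraction_field (D : comNzRingType) (Q : fieldType)
    (f : {rmorphism D -> Q}) : Prop :=
  injective f /\ forall q, exists a b, b != 0 /\ q = f a / f b.

(* For [D] mapping into the center of [R] by [u] and into [K] by [f], the
   [K]-algebra [B] with [j] is the tensor product of [R] and [K] over [D],
   [j] being r |-> r (x) 1: extension of scalars by its universal property. *)
Definition is_scalar_extension (D : comNzRingType) (R : nzRingType)
    (u : {rmorphism D -> R}) (K : comNzRingType) (f : {rmorphism D -> K})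
    (B : algType K) (j : {rmorphism R -> B}) : Prop :=
  (forall z, j (u z) = (f z)%:A) /\
  forall (M : lmodType K) (g : {additive R -> M}),
    (forall z r, g (u z * r) = f z *: g r) ->
    exists h : {linear B -> M}, (forall r, h (j r) = g r) /\
      forall h' : {linear B -> M}, (forall r, h' (j r) = g r) -> h' =1 h.

Definition is_prime_ring (R : nzRingType) : Prop :=
  forall a b : R, (forall x, a * x * b = 0) -> a = 0 \/ b = 0.

Definition is_maximal_order (R : nzRingType) : Prop :=
  [/\ is_prime_ring R, fg_module (val : center R -> R)
    & exists (Q : fieldType) (f : {rmorphism center R -> Q})
             (A : unitAlgType Q) (j : {rmorphism R -> A}),
      [/\ is_fraction_field f, is_scalar_extension (val : center R -> R) f j
        & ~ exists S : {pred A},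
            [/\ subring_closed S, forall r, j r \in S,
                exists2 s, s \in S & forall r, s <> j r
              & exists a b : A, [/\ a \is a GRing.unit, b \is a GRing.unit
                  & forall s, s \in S -> exists r, a * s * b = j r]]]].

(* [t] maps [R] to its center.  The map [j], r |-> r (x) 1, is the composite
   of R -> R (x) Q and R (x) Q -> R (x) F.  The matrix size is positive because
   [R] is nonzero. *)
Definition is_reduced_trace (R : nzRingType) (t : R -> R) : Prop :=
  exists (Q : fieldType) (f : {rmorphism center R -> Q})
         (F : fieldExtType Q) (B : algType F) (j : {rmorphism R -> B})
         (n : nat) (phi : {lrmorphism B -> 'M[F]_n.+1}),
    [/\ is_fraction_field f,
        is_scalar_extension (val : center R -> R) (in_alg F \o f) j,
        bijective phi
      & forall r, exists z : center R,
          val z = t r /\ (f z)%:A = \tr (phi (j r))].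

(* [p] lies in Z[1/k!][x_1,...,x_k] and satisfies
   sigma_k = p(psi_1,...,psi_k) in d variables; the i-th variable of [p],
   counted from 0, is x_(i+1). *)
Definition is_newton_poly (d k : nat) (p : {mpoly rat[k]}) : Prop :=
  (forall m, exists e : nat, p@_m * (k`!%:R) ^+ e \is a Num.int) /\
  p \mPo [tuple \sum_(l < d) 'X_l ^+ i.+1 | i < k] = mesym d rat k.

Section CayleyHamilton.
Variables (k : fieldType) (R : algType k) (C : comAlgType k).
Variables (iota : {lrmorphism C -> R}) (tr : R -> C).

(* When char k = q > 0, [ratr] is not a ring morphism, but it is
   multiplicative and additive on rationals with denominator prime to q, which
   covers the coefficients of [p] as soon as q > i. *)
Definition ch_coef (i : nat) (p : {mpoly rat[i]}) (a : R) : C :=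
  mmap (fun q : rat => (ratr q : k)%:A) (fun j : 'I_i => tr (a ^+ j.+1)) p.

Definition ch_poly (d : nat) (p : forall i, {mpoly rat[i]}) (a : R) : {poly C} :=
  'X^d + \sum_(1 <= i < d.+1) ((-1) ^+ i * ch_coef (p i) a) *: 'X^(d - i).

Definition is_cayley_hamilton (d : nat) : Prop :=
  exists p : forall i, {mpoly rat[i]},
    [/\ forall i, (0 < i <= d)%N -> is_newton_poly d (p i),
        forall a, (map_poly iota (ch_poly d p a)).[a] = 0
      & tr 1 = d%:R].

End CayleyHamilton.

(* Main.v *)
(* The derivation {c, -} maps det (tr (r_i s_j)) to a sum of determinants of the
   same kind, in which one r_i or one s_j is replaced by its image under d_c;
   hence MD_l is a Poisson ideal, and the zero set of a Poisson ideal is a union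
   of symplectic cores.  It remains to see that D_l and MD_l have the same zero
   set.  At a maximal ideal m with residue field K this says that, if the
   symmetric form (x, y) |-> tr (xy) mod m has rank at least l, then it has a
   nonzero l x l Gram determinant; this holds for every symmetric form over K
   that is not alternating, because such a form has an orthogonal basis
   (Albert).  In characteristic different from 2 a nonzero symmetric form is
   never alternating.  In characteristic 2 a reduced trace satisfies
   tr (x^2) = (tr x)^2, and in the Cayley-Hamilton case d = 1, so tr 1 = 1. *)

Require Import Defs.
From HB Require Import structures.
From mathcomp Require Import all_boot all_order all_algebra all_field.
From mathcomp Require Import boolp classical_sets.
From mathcomp Require Import mpoly.
Set Implicit Arguments.
Unset Strict Implicit.
Unset Printing Implicit Defensive.
Import GRing.Theory.
Local Open Scope ring_scope.

(** * Derivatives of determinants *)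

Section Determinant.
Variables (C : comNzRingType) (l : nat).
Implicit Types (A B : 'M[C]_l) (i j : 'I_l).

Definition set_row A i (x : 'I_l -> C) : 'M[C]_l :=
  \matrix_(a, b) (if a == i then x b else A a b).

Lemma det_set_row A i x :
  \det (set_row A i x) = \sum_j x j * cofactor A i j.
Proof.
rewrite (expand_det_row _ i); apply: eq_bigr => j _; rewrite mxE eqxx.
congr (_ * (_ * \det _)); apply/matrixP => a b.
by rewrite !mxE eq_sym (negPf (neq_lift _ _)).
Qed.

Lemma derivation_prod (D : {additive C -> C}) :
    (forall x y, D (x * y) = D x * y + x * D y) ->
  forall n (x : 'I_n -> C),
    D (\prod_i x i) = \sum_i \prod_j (if j == i then D (x j) else x j).
Proof.
move=> DM; elim=> [|n IH] x.
  (* The empty product needs [D 1 = 0], which follows from [D (1 * 1) = D 1 + D 1]. *)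
  rewrite !big_ord0; apply: (addrI (D 1)).
  by rewrite addr0 -{3}[1]mulr1 DM mulr1 mul1r.
rewrite big_ord_recl DM IH [RHS]big_ord_recl big_ord_recl eqxx; congr (_ * _ + _).
by rewrite big_distrr; apply: eq_bigr => i _; rewrite big_ord_recl.
Qed.

(** In each term of the permutation expansion, [D] hits one row at a time. For a fixed row [i], the
    resulting terms sum to the determinant with row [i] replaced by its derivative. *)
Lemma derivation_det (D : {additive C -> C}) :
    (forall x y, D (x * y) = D x * y + x * D y) ->
  forall A, D (\det A) = \sum_i \sum_j D (A i j) * cofactor A i j.
Proof.
move=> DM A; under [RHS]eq_bigr do rewrite -(det_set_row A).
rewrite raddf_sum exchange_big; apply: eq_bigr => s _ /=.
rewrite mulr_sign (fun_if D) raddfN derivation_prod // -mulr_sign big_distrr.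
apply: eq_bigr => i _; congr (_ * _).
by apply: eq_bigr => j _; rewrite mxE; case: eqP => // ->.
Qed.

End Determinant.

(** * Orthogonal families for symmetric forms *)

(* [V] is not assumed to be a module over [K]: [act a x] will be the product of
   [x] and an arbitrary lift of [a] to the ring of which [K] is a residue
   field. *)
Section SymmetricForm.
Variables (K : fieldType) (V : zmodType) (act : K -> V -> V) (b : V -> V -> K).
Hypothesis bC : forall x y, b x y = b y x.
Hypothesis bDl : forall x y z, b (x + y) z = b x z + b y z.
Hypothesis bZl : forall a x z, b (act a x) z = a * b x z.

Local Lemma bDr x y z : b x (y + z) = b x y + b x z.
Proof. by rewrite bC bDl !(bC x). Qed.

Local Lemma bZr a x z : b x (act a z) = a * b x z.
Proof. by rewrite bC bZl bC. Qed.

Local Lemma b0r x : b x 0 = 0.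
Proof. by apply: (addrI (b x 0)); rewrite -bDr !addr0. Qed.

(** Polarization: if every vector were isotropic, [b (x + y) (x + y)] would be twice [b x y]. *)
Lemma nonisotropic_vector :
  2%:R != 0 :> K -> (exists x y, b x y != 0) -> exists x, b x x != 0.
Proof.
move=> two0 [x [y bxy]]; apply: contrapT => H.
have b0 z : b z z = 0 by apply: contrapT => /eqP bz; apply: H; exists z.
have := b0 (x + y); rewrite bDl !bDr !b0 addr0 add0r (bC y) -mulr2n -mulr_natl.
by move/eqP; rewrite mulf_eq0 (negPf two0) (negPf bxy).
Qed.

Definition orthogonal_to t (u : 'I_t -> V) x := forall i, b (u i) x = 0.

(* If the vectors orthogonal to an orthogonal family of [t] nonisotropic
   vectors form a totally isotropic space, then [b] has rank at most [t]. *)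
Lemma orthogonal_family_rank t (u : 'I_t -> V) :
    (forall i j, i != j -> b (u i) (u j) = 0) ->
    (forall i, b (u i) (u i) != 0) ->
    (forall x y, orthogonal_to u x -> orthogonal_to u y -> b x y = 0) ->
  forall l (r s : 'I_l -> V), (t < l)%N ->
    \det (\matrix_(i, j) b (r i) (s j)) = 0.
Proof.
move=> uo un iso l r s tl.
have bsum x (I : finType) (F : I -> V) : b x (\sum_i F i) = \sum_i b x (F i).
  by apply: (big_morph (b x)); [exact: bDr | exact: b0r].
(* Gram-Schmidt: [- pr x] is the orthogonal projection of [x] onto the span of [u]. *)
pose coef x i := b (u i) x / b (u i) (u i).
pose pr x := \sum_i act (- coef x i) (u i).
have orth x : orthogonal_to u (x + pr x).
  move=> i; rewrite bDr bsum (bigD1 i) //= big1 => [|j ji].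
    by rewrite addr0 bZr /coef mulNr divfK // subrr.
  by rewrite bZr uo ?mulr0 // eq_sym.
have bE x y : b x y = \sum_i b x (u i) * coef y i.
  have H : b (pr x) (y + pr y) = 0.
    rewrite bC bsum big1 // => i _.
    by rewrite bZr bC orth mulr0.
  have := iso _ _ (orth x) (orth y).
  rewrite bDl H addr0 bDr bsum => /eqP; rewrite addr_eq0 => /eqP ->.
  rewrite -sumrN; apply: eq_bigr => i _.
  by rewrite bZr mulNr opprK mulrC.
(* The matrix factors through dimension [t], so its rank is less than [l]. *)
pose P : 'M_(l, t) := \matrix_(i, j) b (r i) (u j).
pose Q : 'M_(t, l) := \matrix_(i, j) coef (s j) i.
have -> : (\matrix_(i, j) b (r i) (s j)) = P *m Q.
  apply/matrixP => i j; rewrite !mxE bE.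
  by apply: eq_bigr => a _; rewrite !mxE.
apply/eqP; rewrite -[_ == 0]negbK -unitfE -unitmxE -row_free_unit.
apply/negP => /eqP rk; have := leq_trans (mxrankM_maxr P Q) (rank_leq_row Q).
by rewrite rk leqNgt tl.
Qed.

(* If the complement of [x] is alternating but not zero, say [b w1 w2 != 0],
   then the complement of [x + w1] contains the nonisotropic vector
   [w2 - (b w1 w2 / b x x) x]. *)
Lemma nonisotropic_extension (P : V -> Prop) :
    (forall x y, P x -> P y -> P (x + y)) -> (forall a x, P x -> P (act a x)) ->
    (exists x, P x /\ b x x != 0) ->
  exists x, [/\ P x, b x x != 0
    & (exists y, [/\ P y, b x y = 0 & b y y != 0]) \/
      forall y z, P y -> P z -> b x y = 0 -> b x z = 0 -> b y z = 0].
Proof.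
move=> PD PZ [x [Px bx]].
have [H|] := pselect (exists y, [/\ P y, b x y = 0 & b y y != 0]).
  by exists x; split=> //; left.
move=> alt.
have altE y : P y -> b x y = 0 -> b y y = 0.
  by move=> Py xy; apply: contrapT => /eqP bn; apply: alt; exists y.
have [H|] := pselect (forall y z, P y -> P z -> b x y = 0 -> b x z = 0 -> b y z = 0).
  by exists x; split=> //; right.
move/existsNP=> [v] /existsNP[w] /not_implyP[Pv] /not_implyP[Pw].
case/not_implyP=> xv /not_implyP[xw /eqP vw].
exists (x + v); split; first exact: PD.
  by rewrite bDl !bDr xv (bC v x) xv (altE v) // !addr0.
left; exists (act (- (b v w / b x x)) x + w); split.
- by apply: PD => //; apply: PZ.
- by rewrite bDl !bDr !bZr xw (bC v x) xv mulr0 !add0r addr0 mulNr divfK // addNr.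
- rewrite bDl !bDr !bZl !bZr xw (bC w x) xw (altE w) // !mulr0 !addr0.
  by rewrite !mulNr mulrN opprK divfK // mulf_neq0 // mulf_neq0 // invr_eq0.
Qed.

(** An orthogonal family of nonisotropic vectors is extended to length [l]; its Gram matrix is
    diagonal with nonzero entries. A totally isotropic complement at some [t < l] would contradict
    the rank forced by [r] and [s]. *)
Lemma symmetric_gram_det l (r s : 'I_l -> V) :
    \det (\matrix_(i, j) b (r i) (s j)) != 0 -> (exists x, b x x != 0) ->
  exists u : 'I_l -> V, \det (\matrix_(i, j) b (u i) (u j)) != 0.
Proof.
move=> rs nalt.
(* The disjunction in the invariant excludes the only obstruction to the induction, a complement
   that is alternating but not zero. *)
suff /(_ l (leqnn l)) [u [uo un _]] : forall t, (t <= l)%N -> exists u : 'I_t -> V,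
    [/\ forall i j, i != j -> b (u i) (u j) = 0, forall i, b (u i) (u i) != 0
      & (exists x, orthogonal_to u x /\ b x x != 0) \/
        forall x y, orthogonal_to u x -> orthogonal_to u y -> b x y = 0].
  exists u; have -> : (\matrix_(i, j) b (u i) (u j))
      = diag_mx (\row_i b (u i) (u i)).
    apply/matrixP => i j; rewrite !mxE; case: eqP => [->|/eqP ij] //=.
    by rewrite mulr0n uo.
  by rewrite det_diag; apply/prodf_neq0 => i _; rewrite mxE.
elim => [_|t IH tl].
  have [x bx] := nalt.
  by exists (fun=> 0); split=> [[]|[]|] //; left; exists x; split=> // -[].
have [u [uo un [ex|iso]]] := IH (ltnW tl); last first.
  by case/eqP: rs; apply: orthogonal_family_rank uo un iso _ _ _ tl.
have [|||x [ux bx H]] := @nonisotropic_extension (orthogonal_to u).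
- by move=> y z uy uz i; rewrite bDr uy uz addr0.
- by move=> a y uy i; rewrite bZr uy mulr0.
- exact: ex.
pose u' (i : 'I_t.+1) := oapp u x (unlift ord_max i).
have u'P y : orthogonal_to u' y <-> orthogonal_to u y /\ b x y = 0.
  split=> [o|[o xy] i]; last first.
    by rewrite /u'; case: unliftP => [j|] _ //=; exact: o.
  split=> [i|]; last by have := o ord_max; rewrite /u' unlift_none.
  by have := o (lift ord_max i); rewrite /u' liftK.
exists u'; split.
- move=> i j; rewrite /u'; case: unliftP => [i'|] ->; case: unliftP => [j'|] -> //=.
  + by rewrite (inj_eq lift_inj) => /uo.
  + by rewrite bC ux.
  + by rewrite eqxx.
- move=> i; rewrite /u'; case: unliftP => [j|] _ //=; exact: un.
- case: H => [[y [uy xy yy]]|H].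
    by left; exists y; split=> //; apply/u'P.
  by right=> y z /u'P[? ?] /u'P[? ?]; apply: H.
Qed.

End SymmetricForm.

(** * Residue fields and generated ideals *)

Local Open Scope classical_set_scope.

Lemma residue_field (C : comNzRingType) (m : set C) : MaxSpec m ->
  exists (K : fieldType) (p : {rmorphism C -> K}),
    (forall c, p c = 0 <-> m c) /\ forall a, exists c, p c = a.
Proof.
move=> [[m0 mD mM] m1 mmax].
pose S : pred C := fun x => `[< m x >].
have SP x : reflect (m x) (x \in S) by exact: asboolP.
have idS : idealr_closed S.
  split; [exact/SP | exact/SP | move=> a x y /SP mx /SP my; apply/SP].
  by apply: mD => //; apply: mM.
pose I : idealr C := HB.pack (S : C -> bool) (isIdealr.Build C S idS).
pose Q : comNzRingType := {ideal_quot I}.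
pose p : {rmorphism C -> Q} := \pi_({ideal_quot I})%qT.
have p_surj (a : Q) : exists c, p c = a by exists (repr a); exact: reprK.
have p0 c : p c = 0 <-> m c.
  rewrite -(rmorph0 p); split=> [/eqP|mc].
    by rewrite -(@Quotient.idealrBE _ I) subr0 => /SP.
  by apply/eqP; rewrite -(@Quotient.idealrBE _ I) subr0; apply/SP.
have inv_ex (a : Q) : exists a', a != 0 -> a' * a = 1.
  have [->|a0] := eqVneq a 0; first by exists 0.
  have [c ca] := p_surj a.
  have [J1|J1] := pselect (exists x y, m x /\ x + y * c = 1).
    case: J1 => x [y [mx xy]]; exists (p y) => _.
    by rewrite -ca -rmorphM -[LHS]add0r -((p0 x).2 mx) -rmorphD xy rmorph1.
  (* If [1] is not in the ideal [m + C c], maximality makes this ideal equal to [m], so [c] lies in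
     [m]. *)
  case/eqP: a0; rewrite -ca; apply/p0.
  rewrite -(mmax [set z | exists x y, m x /\ z = x + y * c]).
  - by exists 0, 1; rewrite add0r mul1r.
  - split.
    + by exists 0, 0; rewrite mul0r addr0.
    + move=> _ _ [x [y [mx ->]]] [x' [y' [mx' ->]]].
      by exists (x + x'), (y + y'); rewrite mulrDl addrACA; split=> //; apply: mD.
    + move=> e _ [x [y [mx ->]]]; exists (e * x), (e * y).
      by rewrite mulrDr mulrA; split=> //; apply: mM.
  - by move=> x mx; exists x, 0; rewrite mul0r addr0.
  - by case=> x [y [mx E]]; apply: J1; exists x, y.
have [inv invP] := choice inv_ex.
(* The value of [inv] at [0] is arbitrary, whereas a field structure requires [0] there. *)
pose inv' a := if a == 0 then 0 else inv a.
have mulVf (a : Q) : a != 0 -> inv' a * a = 1.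
  by move=> a0; rewrite /inv' (negPf a0) invP.
have inv0 : inv' 0 = 0 by rewrite /inv' eqxx.
pose K : fieldType := HB.pack Q (GRing.ComNzRing_isField.Build Q mulVf inv0).
by exists K, p.
Qed.

Section Ideals.
Variable C : comNzRingType.

Lemma sub_ideal_gen (G : set C) : G `<=` ideal_gen G.
Proof. by move=> x Gx I [_]; apply. Qed.

Lemma ideal_gen_min (G I : set C) : is_ideal I -> G `<=` I -> ideal_gen G `<=` I.
Proof. by move=> HI GI x; apply. Qed.

Lemma ideal_gen_ideal (G : set C) : is_ideal (ideal_gen G).
Proof.
split=> [I [[]] //|x y xI yI I HI|a x xI I HI].
  by have [[_ ID _] _] := HI; apply: ID; [apply: xI | apply: yI].
by have [[_ _ IM] _] := HI; apply: IM; apply: xI.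
Qed.

Lemma ideal_sum (I : set C) (T : finType) (F : T -> C) :
  is_ideal I -> (forall i, I (F i)) -> I (\sum_i F i).
Proof. by case=> I0 ID _ IF; apply: big_ind. Qed.

End Ideals.

(** * Modified discriminant ideals and their zero sets *)

Section PoissonTraceOrder.
Variables (k : comNzRingType) (R : algType k) (C : comAlgType k).
Variables (iota : {lrmorphism C -> R}) (br : C -> C -> C).
Variables (d : C -> R -> R) (tr : R -> C).
Hypothesis pto : is_poisson_trace_order iota br d tr.

Lemma trace_bracket c r s : br c (tr (r * s)) = tr (d c r * s) + tr (r * d c s).
Proof.
have [o t <-] := pto.
by rewrite (order_der o c).2 (trace_add t).
Qed.

Lemma MD_poisson l : is_poisson_ideal br (MD l tr).
Proof.
have [o t _] := pto.
have MDI : is_ideal (MD l tr) by exact: ideal_gen_ideal.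
have [MD0 MDD MDM] := MDI.
have brB c : zmod_morphism (br c).
  move=> x y; have := bracket_linear_r (order_poisson o) c (-1) y x.
  by rewrite !scaleN1r !(addrC (- _)).
have brM := bracket_leibniz (order_poisson o).
split=> // c x xMD.
pose D : {additive C -> C} :=
  HB.pack (br c) (GRing.isZmodMorphism.Build C C (br c) (brB c)).
(* The elements of [MD l tr] that [D] keeps in it form an ideal, so checking the generators
   suffices. *)
suff /(_ x xMD)[] : MD l tr `<=` [set x | MD l tr x /\ MD l tr (D x)] by [].
apply: ideal_gen_min.
  split=> [|y z [Iy Dy] [Iz Dz]|a y [Iy Dy]].
  - by split; [exact: MD0 | rewrite raddf0].
  - by split; [|rewrite raddfD]; apply: MDD.
  - by split; [exact: MDM | rewrite [D _]brM; apply: MDD; exact: MDM].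
move=> _ [r [s ->]]; split; first by apply: sub_ideal_gen; exists r, s.
set A := \matrix_(i, j) _.
(* Terms that differentiate [r i] are grouped by rows, those that differentiate [s j] by columns,
   treated as rows of the transpose. *)
have -> : D (\det A) =
    \sum_i \det (set_row A i (fun j => tr (d c (r i) * s j)))
  + \sum_j \det (set_row A^T j (fun i => tr (r i * d c (s j)))).
  rewrite derivation_det; last exact: brM.
  under eq_bigr => i _ do under eq_bigr => j _ do
    rewrite mxE /= trace_bracket mulrDl.
  under eq_bigr do rewrite big_split.
  rewrite big_split; congr (_ + _); first by under [RHS]eq_bigr do rewrite det_set_row.
  rewrite exchange_big; apply: eq_bigr => j _; rewrite det_set_row.
  by apply: eq_bigr => i _; rewrite cofactor_tr.
apply: MDD; apply: ideal_sum => // i; apply: sub_ideal_gen.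
  exists (fun a => if a == i then d c (r i) else r a), s; congr (\det _).
  by apply/matrixP => a b; rewrite !mxE; case: eqP.
exists r, (fun a => if a == i then d c (s i) else s a); rewrite -det_tr.
by congr (\det _); apply/matrixP => a b; rewrite !mxE; case: eqP.
Qed.

(** A Poisson ideal inside [m] lies in the Poisson core of [m], hence in every [n] with the same
    core. *)
Lemma zero_set_poisson_ideal (I : set C) :
  is_poisson_ideal br I -> is_union_of_symplectic_cores br (zero_set I).
Proof.
move=> IP; exists [set symplectic_core br m | m in zero_set I].
split=> [_ [m [mmax _] <-]|]; first by exists m.
apply/seteqP; split=> [m [mmax Im]|n [_ [m [mmax Im] <-] [nmax nm]]].
  by exists (symplectic_core br m); [exists m | split].
split=> // x Ix.
have : poisson_core br n x by rewrite nm; exists I.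
by case=> J [_]; apply.
Qed.

(** The hypothesis says that the trace form modulo [m] is zero or not alternating, as
    [symmetric_gram_det] requires. *)
Lemma zero_set_discr l : (0 < l)%N ->
    (forall m, MaxSpec m -> (exists r s, ~ m (tr (r * s))) ->
       exists r, ~ m (tr (r * r))) ->
  zero_set (discr l tr) = zero_set (MD l tr).
Proof.
move=> l0 nalt; have [o t _] := pto.
apply/seteqP; split=> m [mmax Im]; split=> //; last first.
  move=> x xD; apply: Im; apply: (ideal_gen_min _ _ xD).
    exact: ideal_gen_ideal.
  by move=> _ [r ->]; apply: sub_ideal_gen; exists r, r.
have [K [p [pP psurj]]] := residue_field mmax.
have [lift liftP] := choice psurj.
apply: ideal_gen_min => [|_ [r [s ->]]]; first by case: mmax.
pose b x y := p (tr (x * y)).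
pose act a x := iota (lift a) * x.
have bC x y : b x y = b y x by rewrite /b (trace_comm t).
have bD x y z : b (x + y) z = b x z + b y z.
  by rewrite /b mulrDl (trace_add t) rmorphD.
have bZ a x z : b (act a x) z = a * b x z.
  by rewrite /b /act -mulrA (trace_scale t) rmorphM liftP.
have detE (u v : 'I_l -> R) : p (\det (\matrix_(i, j) tr (u i * v j)))
    = \det (\matrix_(i, j) b (u i) (v j)).
  rewrite -det_map_mx; congr (\det _).
  by apply/matrixP => i j; rewrite !mxE.
apply: contrapT => /pP/eqP; rewrite detE => rs.
have [|u /eqP] := symmetric_gram_det bC bD bZ rs.
  have [|x /pP/eqP bx] := nalt m mmax; last by exists x.
  (* If the form is zero modulo [m], the first row vanishes. Here [0 < l] matters: the empty
     determinant is [1]. *)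
  apply: contrapT => H; case/eqP: rs.
  case: l l0 {Im detE} r s => // l _ r s.
  rewrite (expand_det_row _ ord0) big1 // => j _; rewrite mxE.
  suff -> : b (r ord0) (s j) = 0 by rewrite mul0r.
  by apply/pP; apply: contrapT => Hm; apply: H; exists (r ord0), (s j).
rewrite -detE; case; apply/pP; apply: Im; apply: sub_ideal_gen.
by exists u.
Qed.

End PoissonTraceOrder.

(** * Reduced traces in characteristic 2 *)

(** Off-diagonal terms cancel in pairs. *)
Lemma sum_symmetric_char2 (A : comNzRingType) n (f : 'I_n -> 'I_n -> A) :
    2%:R = 0 :> A -> (forall i j, f i j = f j i) ->
  \sum_i \sum_j f i j = \sum_i f i i.
Proof.
move=> A2; elim: n f => [|n IH] f fC; first by rewrite !big_ord0.
rewrite big_ord_recl [RHS]big_ord_recl big_ord_recl -addrA; congr (_ + _).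
under [X in _ + X]eq_bigr do rewrite big_ord_recl fC.
by rewrite big_split IH // addrA -mulr2n -mulr_natl A2 mul0r add0r.
Qed.

(** Both sides are double sums of symmetric families with the same diagonal [M i i ^+ 2]. *)
Lemma mxtrace_sqr_char2 (A : comNzRingType) n (M : 'M[A]_n) :
  2%:R = 0 :> A -> \tr (M *m M) = \tr M ^+ 2.
Proof.
move=> A2; rewrite expr2 big_distrlr /= sum_symmetric_char2 //; last first.
  by move=> i j; rewrite mulrC.
rewrite -(sum_symmetric_char2 (f := fun i j => M i j * M j i)) // => [|i j].
  by apply: eq_bigr => i _; rewrite mxE.
by rewrite mulrC.
Qed.

(** The matrix identity over [F] pulls back along the injections of the center into [Q] and of [Q]
    into [F]. *)
Lemma reduced_trace_sqr_char2 (R : nzRingType) (t : R -> R) :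
  2%:R = 0 :> R -> is_reduced_trace t -> forall x, t (x * x) = t x ^+ 2.
Proof.
move=> R2 [Q [f [F [B [j [n [phi [[finj _] _ _ tE]]]]]]]] x.
have F2 : 2%:R = 0 :> F.
  suff Z2 : 2%:R = 0 :> center R by rewrite -(rmorph_nat (in_alg F \o f)) Z2 rmorph0.
  by apply: val_inj; rewrite rmorph_nat rmorph0.
have [z [<- zE]] := tE x; have [y [<- yE]] := tE (x * x).
rewrite -rmorphXn; congr val; apply: finj; apply: (fmorph_inj (in_alg F)) => /=.
by rewrite yE !rmorphM /= mxtrace_sqr_char2 // -zE expr2 -scalerAl mul1r scalerA.
Qed.

Theorem theoremC :
  (forall (k : comNzRingType) (R : algType k) (C : comAlgType k)
          (iota : {lrmorphism C -> R}) (br : C -> C -> C)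
          (d : C -> R -> R) (tr : R -> C),
     is_poisson_trace_order iota br d tr ->
     forall l : nat, (0 < l)%N -> is_poisson_ideal br (MD l tr))
  /\
  (forall (k : fieldType) (R : algType k) (C : comAlgType k)
          (iota : {lrmorphism C -> R}) (br : C -> C -> C)
          (d : C -> R -> R) (tr : R -> C),
     is_poisson_trace_order iota br d tr ->
     fg_algebra C ->
     [/\ is_maximal_order R, is_whole_center iota
       & is_reduced_trace (fun r => iota (tr r))]
     \/
     (exists n : nat,
        [/\ (0 < n)%N, is_cayley_hamilton iota tr n
          & forall q : nat, (1 <= q <= n)%N -> q \notin [pchar k]]) ->
     forall l : nat, (0 < l)%N ->
       is_union_of_symplectic_cores br (zero_set (discr l tr))).
Proof.
split=> [k R C iota br d tr pto l _|k R C iota br d tr pto _ hyp l l0].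
  exact: MD_poisson pto l.
rewrite (zero_set_discr pto) //; last first.
  move=> m mmax [r [s rs]]; have [K [p [pP _]]] := residue_field mmax.
  have [o t _] := pto; move: rs => /pP/eqP rs.
  have [k2|k2] := eqVneq (2%:R : k) 0; last first.
    have K2 : 2%:R != 0 :> K.
      by rewrite -(rmorph_nat (p \o in_alg C)) fmorph_eq0.
    have bC x y : p (tr (x * y)) = p (tr (y * x)) by rewrite (trace_comm t).
    have bD x y z : p (tr ((x + y) * z)) = p (tr (x * z)) + p (tr (y * z)).
      by rewrite mulrDl (trace_add t) rmorphD.
    have [|x bx] := nonisotropic_vector bC bD K2; first by exists r, s.
    by exists x => /pP/eqP; apply/negP.
  case: hyp => [[_ _ red]|[n [n0 [_ [_ _ tr1]] chk]]].
    (* The witness [r * s] works because the trace of its square is the square of [tr (r * s)],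
       nonzero in [K]. *)
    exists (r * s) => /pP/eqP; apply/negP.
    have R2 : 2%:R = 0 :> R by rewrite -(rmorph_nat (in_alg R)) k2 rmorph0.
    have := reduced_trace_sqr_char2 R2 red (r * s); rewrite -rmorphXn.
    by move/(order_inj o) ->; rewrite rmorphXn expf_neq0.
  (* As [k] has characteristic 2, the bound on the characteristic leaves only [n = 1]. *)
  exists 1 => /pP/eqP; apply/negP; rewrite mulr1 tr1.
  suff -> : n = 1%N by rewrite rmorph1 oner_neq0.
  have := chk 2%N; rewrite inE /= k2 eqxx; case: n n0 {tr1 chk} => [|[|n]] //= _.
  by move=> /(_ isT).
exact: zero_set_poisson_ideal (MD_poisson pto l).
Qed.
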